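(* For every cyclic formula $\phi$ and every vertex $a$ of $\phi$ with label $\$$ of arity $n$ (a propositional variable counting as a $0$-ary label), $\mathsf{GL}\vdash \mathsf{js}^\star(\phi,a)\leftrightarrow \$(\mathsf{js}^\star(\phi,S_0a),\dots,\mathsf{js}^\star(\phi,S_{n-1}a))$.
   Context: Cyclic formulas. Labels: $\bot,\top$ and propositional variables (arity 0), $\neg,\Box$ (arity 1), $\wedge,\vee,\to$ (arity 2). A graph is $\langle V,r,S,\lambda\rangle$ with $V$ finite, root $r$, labelling $\lambda$, and $S:V\to V^{*}$ giving the ordered successors, the length of $S(a)$ being the arity of $\lambda(a)$; $S_i(a)$ is the $i$-th successor; every vertex is reachable from $r$. A cycle is a set of pairwise distinct vertices $a_0,\dots,a_{k-1}$ with $a_{j+1}$ a successor of $a_j$ and $a_0$ a successor of $a_{k-1}$. A formula is a graph in which every cycle contains a vertex labelled $\Box$ (a $\Box$-occurrence). $\langle\phi\rangle_a$ is the subgraph generated by $a$ (root $a$). Substitution $\phi[p:\psi]$: disjoint union of $\phi$ and $\psi$, identifying each $p$-labelled vertex of $\phi$ with the root of $\psi$ (keeping the label of $\psi$'s root). For $p$ not occurring in $\phi$: if the root $r$ of $\phi$ is on no cycle, $\langle\phi/p\rangle:=\phi$; otherwise $\langle\phi/p\rangle$ adds a fresh vertex labelled $p$ without successors and redirects all edges into $r$ to it (root still $r$); $\langle\phi/\psi\rangle:=\langle\phi/p\rangle[p:\psi]$. Acyclic formulas are ordinary modal formulas; $\mathsf{GL}$ is ordinary Löb's logic on them. $\mathsf{js}^\star(\phi,a)$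 (an acyclic formula) is defined by course-of-values induction on the number of cycles of $\phi$ and recursion along successors with $\Box$-occurrences on cycles as base cases: if $a$ is not a $\Box$-occurrence on a cycle and has label $\$$ of arity $n$, $\mathsf{js}^\star(\phi,a):=\$(\mathsf{js}^\star(\phi,S_0a),\dots,\mathsf{js}^\star(\phi,S_{n-1}a))$; if $a$ is a $\Box$-occurrence on a cycle, $\mathsf{js}^\star(\phi,a):=\mathsf{js}^\star(\langle\langle\phi\rangle_a/\top\rangle,a)$. *)

(* Defs.v *)
From HB Require Import structures.
From mathcomp Require Import all_boot.

Set Implicit Arguments.
Unset Strict Implicit.
Unset Printing Implicit Defensive.

Inductive label : Type :=
  LBot | LTop | LVar of nat | LNeg | LBox | LAnd | LOr | LImp.

Definition arity (l : label) : nat :=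
  match l with
  | LBot | LTop | LVar _ => 0
  | LNeg | LBox => 1
  | LAnd | LOr | LImp => 2
  end.

Lemma label_comparable : comparable label.
Proof. by rewrite /comparable /decidable; repeat decide equality. Qed.

HB.instance Definition _ := hasDecEq.Build label (compareP label_comparable).

(** * Cyclic formulas *)

(* Reachability from the root is imposed in [formula] below. *)
Record pregraph : Type := Pregraph {
  vertex :> finType;
  root : vertex;
  lab : vertex -> label;
  succ : forall a : vertex, (arity (lab a)).-tuple vertex
}.

Definition edge (g : pregraph) : rel g := fun a b => b \in succ a.
Arguments edge {g} a b.

(* A cycle is a set of vertices, not a cyclic sequence: two cyclic orderings of
   the same set are one cycle. See [is_cycleP]. *)
Definition is_cycle (g : pregraph) (C : {set g}) : bool :=
  (C != set0) && has (cycle edge) (permutations (enum C)).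

Definition on_cycle (g : pregraph) (a : g) : bool :=
  [exists C : {set g}, is_cycle C && (a \in C)].

Definition ncycles (g : pregraph) : nat := #|[set C : {set g} | is_cycle C]|.

Definition accessible (g : pregraph) : Prop := forall a, connect edge (root g) a.

Definition guarded (g : pregraph) : Prop :=
  forall C : {set g}, is_cycle C -> exists2 a, a \in C & lab a = LBox.

Record formula : Type := Formula {
  graph_of :> pregraph;
  formula_accessible : accessible graph_of;
  formula_guarded : guarded graph_of
}.

Lemma is_cycleP (g : pregraph) (C : {set g}) :
  reflect (exists s : seq g, [/\ s != [::], uniq s, cycle edge s & C =i s])
          (is_cycle C).
Proof.
apply: (iffP andP) => [[C0 /hasP[s]]|[s [s0 Us cs Cs]]].
  rewrite mem_permutations => ps cs; exists s; split=> //.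
  - apply: contraNneq C0 => s0; apply/eqP/setP => x.
    by rewrite -mem_enum -(perm_mem ps) s0 inE.
  - by rewrite (perm_uniq ps) enum_uniq.
  - by move=> x; rewrite (perm_mem ps) mem_enum.
split.
  case: s s0 Us cs Cs => // x s _ _ _ Cs; apply/set0Pn; exists x.
  by rewrite Cs mem_head.
apply/hasP; exists s => //; rewrite mem_permutations uniq_perm ?enum_uniq //.
by move=> x; rewrite mem_enum Cs.
Qed.

Lemma cycle_next (g : pregraph) (C : {set g}) a :
  is_cycle C -> a \in C -> exists2 b, b \in C & edge a b.
Proof.
case/is_cycleP => s [_ Us cs Cs]; rewrite Cs => sa.
by exists (next s a); [rewrite Cs mem_next | apply: next_cycle].
Qed.

Lemma cycle_prev (g : pregraph) (C : {set g}) a :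
  is_cycle C -> a \in C -> exists2 b, b \in C & edge b a.
Proof.
case/is_cycleP => s [_ Us cs Cs]; rewrite Cs => sa.
by exists (prev s a); [rewrite Cs mem_prev | apply: prev_cycle].
Qed.

Lemma cycle_connect (g : pregraph) (C : {set g}) a b :
  is_cycle C -> a \in C -> b \in C -> connect edge a b.
Proof.
case/is_cycleP => s [_ Us cs Cs]; rewrite !Cs => sa sb.
exact: (connect_cycle cs).
Qed.

Lemma cycle_invariant (g : pregraph) (C : {set g}) (P : pred g) a :
  is_cycle C -> (forall x y, edge x y -> P x -> P y) -> a \in C -> P a ->
  {in C, forall b, P b}.
Proof.
move=> cC PE Ca Pa b Cb.
case/connectP: (cycle_connect cC Ca Cb) => p pp ->.
elim: p a Pa pp {Ca} => //= x p IH a Pa /andP[ax xp].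
exact: IH (PE _ _ ax Pa) xp.
Qed.

Lemma cycle_imset (g h : pregraph) (f : g -> h) (C : {set g}) :
  is_cycle C -> {in C &, injective f} ->
  {in C &, forall x y, edge x y -> edge (f x) (f y)} -> is_cycle (f @: C).
Proof.
case/is_cycleP => s [s0 Us cs Cs] If Ef; apply/is_cycleP; exists (map f s); split.
- by case: s s0 {Us cs Cs}.
- by rewrite map_inj_in_uniq // => x y; rewrite -!Cs; apply: If.
- apply: (homo_cycle_in (P := mem C) (e := edge)) cs => //.
  by apply/allP => y; rewrite -Cs.
- move=> y; apply/imsetP/mapP => -[x xC ->]; exists x => //; first by rewrite -Cs.
  by rewrite Cs.
Qed.

Lemma edge_arity0 (g : pregraph) (a b : g) : arity (lab a) = 0 -> edge a b = false.
Proof.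
move=> a0; apply/negbTE/negP => /tnthP[[i ltia] _].
by rewrite a0 in ltia.
Qed.

(** ** Generated subgraph *)

Section Generated.
Variables (g : pregraph) (a : g).

Definition gen_vertex : finType := {b : g | connect edge a b}.

Definition gen_sub (b : g) (ab : connect edge a b) : gen_vertex := exist _ b ab.

Lemma gen_succ_subproof (u : gen_vertex) (i : 'I_(arity (lab (val u)))) :
  connect edge a (tnth (succ (val u)) i).
Proof. exact: connect_trans (valP u) (connect1 (mem_tnth _ _)). Qed.

Definition gen_graph : pregraph :=
  @Pregraph gen_vertex (gen_sub (connect0 edge a)) (fun u => lab (val u))
    (fun u => [tuple gen_sub (gen_succ_subproof i) | i < arity (lab (val u))]).

Lemma gen_edge (u v : gen_graph) : edge u v = edge (val u) (val v).
Proof.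
rewrite /edge /=; apply/tnthP/tnthP => -[i].
  by rewrite tnth_mktuple => ->; exists i.
by move=> e; exists i; rewrite tnth_mktuple; apply: val_inj.
Qed.

Lemma gen_accessible : accessible gen_graph.
Proof.
case=> b ab; case/connectP: (ab) => p pp bE.
elim/last_ind: p b ab pp bE => [|p c IH] b ab.
  by move=> _ /= bE; subst b; apply: eq_connect0; apply: val_inj.
rewrite rcons_path last_rcons => /andP[pp ec] bE; subst b.
have ad: connect edge a (last a p) by apply/connectP; exists p.
apply: connect_trans (IH _ ad pp erefl) (connect1 _).
by rewrite gen_edge.
Qed.

Lemma gen_cycle (C : {set gen_graph}) : is_cycle C -> is_cycle (val @: C : {set g}).
Proof.
move=> cC; apply: (cycle_imset cC); first by move=> x y _ _; apply: val_inj.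
by move=> x y _ _; rewrite gen_edge.
Qed.

Lemma gen_guarded : guarded g -> guarded gen_graph.
Proof.
by move=> gg C /gen_cycle/gg[b /imsetP[u uC bE] lb]; exists u; rewrite //= -bE.
Qed.

Lemma gen_ncycles : ncycles gen_graph <= ncycles g.
Proof.
rewrite /ncycles -(card_imset _ (imset_inj (@val_inj _ _ gen_vertex))).
apply: subset_leq_card; apply/subsetP => D /imsetP[C].
by rewrite !inE => cC ->; apply: gen_cycle.
Qed.

Lemma gen_on_cycle : on_cycle a -> on_cycle (root gen_graph).
Proof.
case/existsP=> C /andP[cC aC].
apply/existsP; exists [set u : gen_graph | val u \in C]; rewrite inE /= aC andbT.
have sub x : x \in C -> connect edge a x by apply: cycle_connect.
case/is_cycleP: (cC) => s [s0 Us cs Cs].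
have sE : map val (pmap insub s : seq gen_graph) = s.
  rewrite (pmap_filter (insubK _)); apply/all_filterP/allP => x.
  by rewrite -Cs isSome_insub => /sub.
apply/is_cycleP; exists (pmap insub s : seq gen_graph); split.
- by apply: contra s0 => /eqP e; rewrite -sE e.
- by rewrite -(map_inj_uniq val_inj) sE.
- rewrite -(eq_cycle (e := relpre val edge)); last by move=> u v; rewrite gen_edge.
  by rewrite -cycle_map sE.
- by move=> u; rewrite inE Cs -{1}sE mem_map //; apply: val_inj.
Qed.
End Generated.

Definition gen (phi : formula) (a : phi) : formula :=
  Formula (@gen_accessible phi a) (gen_guarded (@formula_guarded phi)).

(** ** Cutting the edges into the root *)

Section Cut.
Variables (g : pregraph) (p : nat).

(* [None] is the fresh vertex. *)
Definition cut_lab (u : option g) : label := if u is Some a then lab a else LVar p.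

Definition redirect (b : g) : option g := if b == root g then None else Some b.

Definition cut_succ (u : option g) : (arity (cut_lab u)).-tuple (option g) :=
  match u return (arity (cut_lab u)).-tuple (option g) with
  | Some a => map_tuple redirect (succ a)
  | None => [tuple]
  end.

Definition cut_graph : pregraph :=
  @Pregraph (option g) (Some (root g)) cut_lab cut_succ.

Lemma cut_edgeS (a b : g) :
  edge (Some a : cut_graph) (Some b) = edge a b && (b != root g).
Proof.
rewrite /edge /=; apply/mapP/andP => [[c ac]|[ab br]].
  by rewrite /redirect; case: eqP => // /eqP cr [->].
by exists b => //; rewrite /redirect (negPf br).
Qed.

Lemma cut_edgeN (a : g) : edge (Some a : cut_graph) None = edge a (root g).
Proof.
rewrite /edge /=; apply/mapP/idP => [[c ac]|ar].
  by rewrite /redirect; case: eqP => // <-.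
by exists (root g) => //; rewrite /redirect eqxx.
Qed.

Lemma cut_accessible : accessible g -> on_cycle (root g) -> accessible cut_graph.
Proof.
move=> ag /existsP[C /andP[cC rC]].
have accS a : connect edge (root cut_graph) (Some a : cut_graph).
  case/connectP: (ag a) => q0 pq -> {a}.
  case/shortenP: pq => q pq /=/andP[nr _] _.
  elim/last_ind: q pq nr => [|q c IH]; first by [].
  rewrite rcons_path last_rcons mem_rcons inE negb_or => /andP[pq ec] /andP[rc nr].
  apply: connect_trans (IH pq nr) (connect1 _).
  by rewrite cut_edgeS ec eq_sym.
case=> [a|]; first exact: accS.
case: (cycle_prev cC rC) => b _ br.
by apply: connect_trans (accS b) (connect1 _); rewrite cut_edgeN.
Qed.

Lemma cut_cycleP (C : {set cut_graph}) : is_cycle C ->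
  exists2 D : {set g}, is_cycle D & (root g \notin D) && (C == [set Some x | x in D]).
Proof.
move=> cC; pose f (u : cut_graph) : g := odflt (root g) u.
have nN : None \notin C.
  by apply/negP => /(cycle_next cC)[b _].
have nR : Some (root g) \notin C.
  apply/negP => /(cycle_prev cC)[[b|] _]; last by [].
  by rewrite cut_edgeS eqxx andbF.
exists (f @: C).
  apply: (cycle_imset cC) => [[x|] [y|]|[x|] [y|]]; rewrite ?(negPf nN) //.
    by move=> _ _ /= ->.
  by move=> _ _; rewrite cut_edgeS => /andP[].
apply/andP; split.
  apply/negP => /imsetP[[x|] xC /= e]; last by rewrite xC in nN.
  by rewrite -e in xC; rewrite xC in nR.
rewrite -imset_comp; apply/eqP/setP => u; apply/idP/imsetP => [uC|[[x|] xC ->]] //.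
  by exists u => //; case: u uC nN => //= ->.
by rewrite xC in nN.
Qed.

Lemma cut_guarded : guarded g -> guarded cut_graph.
Proof.
move=> gg C /cut_cycleP[D /gg[a aD la] /andP[_ /eqP->]].
by exists (Some a) => //; apply/imsetP; exists a.
Qed.

Lemma cut_ncycles : on_cycle (root g) -> ncycles cut_graph < ncycles g.
Proof.
case/existsP=> C0 /andP[c0 r0].
pose F (D : {set g}) : {set cut_graph} := [set Some x | x in D].
have IF : injective F by apply: imset_inj; apply: Some_inj.
rewrite /ncycles -[X in _ < X](card_imset _ IF); apply: proper_card.
apply/properP; split.
  apply/subsetP => C; rewrite inE => /cut_cycleP[D cD /andP[_ /eqP->]].
  by rewrite mem_imset // inE.
exists (F C0); first by rewrite mem_imset // inE.
rewrite inE; apply/negP => /cut_cycleP[D _ /andP[rD /eqP/IF e]].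
by rewrite -e r0 in rD.
Qed.
End Cut.

(* <phi/p>, for p not occurring in phi *)
Definition cut (phi : formula) (p : nat) : formula :=
  match boolP (on_cycle (root phi)) with
  | AltTrue h => Formula (cut_accessible (p := p) (@formula_accessible phi) h)
                         (cut_guarded (p := p) (@formula_guarded phi))
  | AltFalse _ => phi
  end.

(** ** Substitution *)

Definition occurs (p : nat) (g : pregraph) : bool := [exists a : g, lab a == LVar p].

Section Subst.
Variables (g : pregraph) (p : nat) (h : pregraph).

Definition kept : finType := {a : g | lab a != LVar p}.

Definition subst_vertex : finType := (kept + h)%type.

Definition subst_inj (a : g) : subst_vertex :=
  if insub a is Some u then inl (u : kept) else inr (root h).

Definition subst_lab (u : subst_vertex) : label :=
  match u with inl a => lab (val a) | inr b => lab b end.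

Definition subst_succ (u : subst_vertex) :
    (arity (subst_lab u)).-tuple subst_vertex :=
  match u return (arity (subst_lab u)).-tuple subst_vertex with
  | inl a => map_tuple subst_inj (succ (val a))
  | inr b => map_tuple inr (succ b)
  end.

Definition subst_graph : pregraph :=
  @Pregraph subst_vertex (subst_inj (root g)) subst_lab subst_succ.

Lemma subst_injP (a : g) :
  (exists2 u : kept, val u = a & subst_inj a = inl u) \/
  (lab a = LVar p /\ subst_inj a = inr (root h)).
Proof.
rewrite /subst_inj; case: insubP => [u _ e|]; first by left; exists u.
by rewrite negbK => /eqP; right.
Qed.

Lemma subst_edge_inj (a b : g) :
  edge a b -> edge (subst_inj a : subst_graph) (subst_inj b).
Proof.
move=> ab; case: (subst_injP a) => [[u ua ->] | [la _]].
  by rewrite -ua in ab; apply: map_f.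
by move: ab; rewrite edge_arity0 // la.
Qed.

Lemma subst_edge_ll (a b : kept) :
  edge (inl a : subst_graph) (inl b) -> edge (val a) (val b).
Proof.
rewrite {1}/edge /= => /mapP[c ac].
by case: (subst_injP c) => [[u e ->] [->]|[_ ->]] //; rewrite e.
Qed.

Lemma subst_edge_rr (a b : h) :
  edge (inr a : subst_graph) (inr b) = edge a b.
Proof. by rewrite /edge /= mem_map // => x y []. Qed.

Lemma subst_edge_rl (a : h) (b : kept) :
  edge (inr a : subst_graph) (inl b) = false.
Proof. by apply/negP => /mapP[]. Qed.

Lemma subst_accessible :
  accessible g -> accessible h -> occurs p g -> accessible subst_graph.
Proof.
move=> ag ah /existsP[v /eqP lv].
have accI a : connect edge (root subst_graph) (subst_inj a : subst_graph).
  case/connectP: (ag a) => q pq -> {a}.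
  elim/last_ind: q pq => [|q c IH]; first by [].
  rewrite rcons_path last_rcons => /andP[pq ec].
  by apply: connect_trans (IH pq) (connect1 _); apply: subst_edge_inj.
case=> [u|b].
  have := accI (val u); case: (subst_injP (val u)) => [[w /val_inj-> ->]//|[]].
  by move=> e; have := valP u; rewrite e eqxx.
have := accI v; case: (subst_injP v) => [[u e]|[_ ->] rr].
  by have := valP u; rewrite e lv eqxx.
apply: connect_trans rr _.
case/connectP: (ah b) => q pq -> {b}.
elim/last_ind: q pq => [|q c IH]; first by [].
rewrite rcons_path last_rcons => /andP[pq ec].
by apply: connect_trans (IH pq) (connect1 _); rewrite subst_edge_rr.
Qed.

Lemma subst_cycleP (C : {set subst_graph}) : is_cycle C ->
  (exists2 D : {set kept}, is_cycle (val @: D : {set g}) & C = [set inl x | x in D])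
  \/ (exists2 D : {set h}, is_cycle D & C = [set inr x | x in D]).
Proof.
move=> cC; case: (boolP [exists b : h, inr b \in C]) => [/existsP[b bC]|/existsPn nr].
  pose isr (u : subst_graph) : bool := if u is inr _ then true else false.
  have allr : {in C, forall u, isr u}.
    apply: (cycle_invariant cC _ bC) => // -[x|x] [y|y] //.
    by rewrite subst_edge_rl.
  right; pose f (u : subst_graph) : h := if u is inr y then y else root h.
  exists (f @: C).
    apply: (cycle_imset cC) => [[x|x] [y|y] /allr // _ /allr //= _ ->//|].
    by move=> [x|x] [y|y] /allr // _ /allr // _; rewrite subst_edge_rr.
  rewrite -imset_comp; apply/setP => u; apply/idP/imsetP => [uC|[[x|x] xC ->]] //.
    by exists u => //; case: u uC => // x /allr.
  by have := allr _ xC.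
left; exists [set x | inl x \in C]; last first.
  apply/setP => u; apply/idP/imsetP => [uC|[x]]; last by rewrite inE => xC ->.
  by case: u uC => [x|x] xC; [exists x; rewrite ?inE | rewrite (negPf (nr x)) in xC].
pose f (u : subst_graph) : g := if u is inl y then val y else root g.
have -> : val @: [set x : kept | inl x \in C] = f @: C.
  apply/setP => y; apply/imsetP/imsetP => -[x].
    by rewrite inE => xC ->; exists (inl x).
  case: x => x xC ->; last by rewrite (negPf (nr x)) in xC.
  by exists x; rewrite ?inE.
apply: (cycle_imset cC) => [[x|x] [y|y]|[x|x] [y|y]]; rewrite ?(negPf (nr _)) //.
  by move=> _ _ /= /val_inj->.
by move=> _ _; apply: subst_edge_ll.
Qed.

Lemma subst_guarded : guarded g -> guarded h -> guarded subst_graph.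
Proof.
move=> gg gh C /subst_cycleP[[D /gg[b /imsetP[u uD bE] lb] ->]|[D /gh[u uD lu] ->]].
  by exists (inl u); [apply/imsetP; exists u | rewrite /= -bE].
by exists (inr u) => //; apply/imsetP; exists u.
Qed.

Lemma subst_ncycles : ncycles h = 0 -> ncycles subst_graph <= ncycles g.
Proof.
move=> /eqP; rewrite cards_eq0 => /eqP h0.
pose F (D : {set g}) : {set subst_graph} := [set inl x | x : kept & val x \in D].
apply: leq_trans (leq_imset_card F _); apply: subset_leq_card.
apply/subsetP => C; rewrite inE => /subst_cycleP[[D cD ->]|[D cD]]; last first.
  by have := in_set0 D; rewrite -h0 inE cD.
apply/imsetP; exists (val @: D); first by rewrite inE.
apply/setP => u; apply/imsetP/imsetP => -[x xD ->]; exists x => //.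
  by rewrite inE mem_imset //; apply: val_inj.
by move: xD; rewrite inE mem_imset //; apply: val_inj.
Qed.
End Subst.

(* phi[p:psi].  When p does not occur in phi, the copy of psi in the disjoint
   union is unreachable from the root and phi[p:psi] is phi. *)
Definition subst (phi : formula) (p : nat) (psi : formula) : formula :=
  match boolP (occurs p phi) with
  | AltTrue h =>
      Formula (subst_accessible (@formula_accessible phi) (@formula_accessible psi) h)
              (subst_guarded (p := p) (@formula_guarded phi) (@formula_guarded psi))
  | AltFalse _ => phi
  end.

(* A variable not occurring in g, see [fresh_occurs]. *)
Definition fresh (g : pregraph) : nat :=
  (\max_(a : g) (if lab a is LVar n then n else 0)).+1.

Lemma fresh_occurs (g : pregraph) : ~~ occurs (fresh g) g.
Proof.
apply/existsPn => a; apply/eqP => la.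
have := leq_bigmax (F := fun a : g => if lab a is LVar n then n else 0) a.
by rewrite la ltnn.
Qed.

(* <phi/psi> *)
Definition loop_subst (phi psi : formula) : formula :=
  subst (cut phi (fresh phi)) (fresh phi) psi.

Definition top_graph : pregraph := @Pregraph unit tt (fun=> LTop) (fun=> [tuple]).

Lemma top_is_cycle (C : {set top_graph}) : is_cycle C = false.
Proof.
apply/negP => cC; case/andP: (cC) => /set0Pn[x xC] _.
by case: (cycle_next cC xC).
Qed.

Lemma top_accessible : accessible top_graph.
Proof. by case. Qed.

Lemma top_guarded : guarded top_graph.
Proof. by move=> C; rewrite top_is_cycle. Qed.

Definition top_formula : formula := Formula top_accessible top_guarded.

(** * Modal formulas and Löb's logic *)

Inductive form : Type :=
  | Bot | Top | Var of nat | Neg of form | Box of form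
  | And of form & form | Or of form & form | Imp of form & form.

Definition Iff (A B : form) : form := And (Imp A B) (Imp B A).

Definition app (l : label) : (arity l).-tuple form -> form :=
  match l return (arity l).-tuple form -> form with
  | LBot => fun=> Bot
  | LTop => fun=> Top
  | LVar n => fun=> Var n
  | LNeg => fun t => Neg (tnth t ord0)
  | LBox => fun t => Box (tnth t ord0)
  | LAnd => fun t => And (tnth t ord0) (tnth t ord_max)
  | LOr => fun t => Or (tnth t ord0) (tnth t ord_max)
  | LImp => fun t => Imp (tnth t ord0) (tnth t ord_max)
  end.

(* Propositional evaluation, with boxed formulas treated as atoms. *)
Fixpoint peval (v : form -> bool) (A : form) : bool :=
  match A with
  | Bot => false
  | Top => true
  | Var _ | Box _ => v A
  | Neg B => ~~ peval v B
  | And B C => peval v B && peval v C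
  | Or B C => peval v B || peval v C
  | Imp B C => peval v B ==> peval v C
  end.

Definition tautology (A : form) : Prop := forall v, peval v A.

Inductive GL : form -> Prop :=
  | GL_taut A : tautology A -> GL A
  | GL_K A B : GL (Imp (Box (Imp A B)) (Imp (Box A) (Box B)))
  | GL_Lob A : GL (Imp (Box (Imp (Box A) A)) (Box A))
  | GL_mp A B : GL (Imp A B) -> GL A -> GL B
  | GL_nec A : GL A -> GL (Box A).

(** * The translation js* *)

Definition stop (g : pregraph) (a : g) : bool := (lab a == LBox) && on_cycle a.

Lemma loop_top_ncycles (phi : formula) (a : phi) :
  on_cycle a -> ncycles (loop_subst (gen a) top_formula) < ncycles phi.
Proof.
move=> ca; apply: leq_trans (gen_ncycles a).
have rc : on_cycle (root (gen a)) := gen_on_cycle ca.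
have t0 : ncycles top_formula = 0.
  by apply/eqP; rewrite cards_eq0 -subset0; apply/subsetP => C; rewrite !inE top_is_cycle.
have cl : ncycles (cut (gen a) (fresh (gen a))) < ncycles (gen a).
  rewrite {1}/cut; case: {-}_ / boolP => [h|]; last by rewrite rc.
  exact: cut_ncycles.
rewrite /loop_subst /subst; case: {-}_ / boolP => [h|_] //.
exact: leq_ltn_trans (subst_ncycles _ _ t0) cl.
Qed.

Definition node : Type := {phi : formula & vertex phi}.

Definition mknode (phi : formula) (a : phi) : node := existT _ phi a.

Definition step (g : pregraph) : rel g := fun a b => ~~ stop a && edge a b.
Arguments step {g} a b.

Definition rank (x : node) : nat := #|connect step (projT2 x)|.

Definition node_lt (x y : node) : Prop :=
  ncycles (projT1 x) < ncycles (projT1 y) \/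
  (ncycles (projT1 x) = ncycles (projT1 y) /\ rank x < rank y).

Lemma lex_wf (T : Type) (f g : T -> nat) :
  well_founded (fun x y => f x < f y \/ (f x = f y /\ g x < g y)).
Proof.
suff H n m x : f x < n -> g x < m ->
    Acc (fun x y => f x < f y \/ (f x = f y /\ g x < g y)) x.
  by move=> x; exact: (H _ _ x (ltnSn _) (ltnSn _)).
elim: n m x => [m x|n IHn]; first by rewrite ltn0.
elim=> [x _|m IHm x xn xm]; first by rewrite ltn0.
constructor=> y [yx|[e yx]].
  by apply: (IHn (g y).+1); [exact: leq_trans yx xn | exact: ltnSn].
by apply: IHm; [rewrite e | exact: leq_trans yx xm].
Qed.

Lemma node_lt_wf : well_founded node_lt.
Proof. exact: lex_wf. Qed.

Lemma node_lt_loop (phi : formula) (a : phi) : stop a ->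
  node_lt (mknode (root (loop_subst (gen a) top_formula))) (mknode a).
Proof. by case/andP=> _ ca; left; apply: loop_top_ncycles. Qed.

Lemma node_lt_succ (phi : formula) (a : phi) (i : 'I_(arity (lab a))) :
  ~~ stop a -> node_lt (mknode (tnth (succ a) i)) (mknode a).
Proof.
move=> na; right; split=> //; rewrite /rank /=.
set b := tnth _ _; have ab : edge a b by apply: mem_tnth.
have sab : step a b by rewrite /step na.
apply: proper_card; apply/properP; split.
  by apply/subsetP => x; apply: connect_trans (connect1 sab).
exists a; first exact: connect0.
apply/negP => /connectP[q0 pq aE].
case/shortenP: pq aE => q pq Uq _ aE.
have cq : cycle step (b :: q) by rewrite /= rcons_path pq -aE.
have cE : cycle edge (b :: q).
  by apply: sub_cycle cq => x y /andP[].
have cC : is_cycle [set x in b :: q].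
  by apply/is_cycleP; exists (b :: q); split=> // x; rewrite inE.
have [x xC lx] := formula_guarded cC.
have xq : x \in b :: q by rewrite inE in xC.
have /andP[] := next_cycle cq xq.
rewrite /stop lx eqxx /= => /negP[].
by apply/existsP; exists [set x in b :: q]; rewrite cC.
Qed.

(* The vertex a of <<phi>_a/T> is its root. *)
Definition js_body (x : node) : (forall y, node_lt y x -> form) -> form :=
  match x return (forall y, node_lt y x -> form) -> form with
  | existT phi a => fun rec =>
      match boolP (stop a) with
      | AltTrue h => rec (mknode (root (loop_subst (gen a) top_formula))) (node_lt_loop h)
      | AltFalse h =>
          app [tuple rec (mknode (tnth (succ a) i)) (node_lt_succ i h)
              | i < arity (lab a)]
      end
  end.

(* See [js_eq] for the recursion equations. *)
Definition js (phi : formula) (a : phi) : form :=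
  Fix node_lt_wf (fun=> form) js_body (mknode a).

Lemma js_eq (phi : formula) (a : phi) :
  js a = if stop a then js (root (loop_subst (gen a) top_formula))
         else app (map_tuple (@js phi) (succ a)).
Proof.
rewrite {1}/js Fix_eq => [|[psi b] f g fg] /=; last first.
  case: {-}_ / boolP => h; first exact: fg.
  by congr app; apply: eq_mktuple => i; apply: fg.
case: {-}_ / boolP => h; first by rewrite ?h.
by rewrite ?(negPf h); congr app; apply: eq_from_tnth => i; rewrite tnth_mktuple tnth_map.
Qed.

(* Main.v *)
(** The vertices of a cyclic formula form a system of modal equations
    [x_v <-> $(x_(S v))].  Löb's rule, applied to the conjunction of all
    equivalences [x_v <-> y_v], shows that its solution is unique up to provable
    equivalence.  If [z] solves the system in which the references to one box
    vertex [a] are replaced by [Top], and [y] solves a system in which they are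
    not, then [z] and [y] agree under the hypothesis [y_a /\ Box y_a], and Löb's
    theorem turns this into [Box z_(S a) <-> y_a].  Used with [a] replaced by
    [Box z_(S a)], this gives solutions by eliminating the boxes one at a time;
    used with the solution [z] that js* provides, by induction on the number of
    cycles, for the looped formula, it shows that js* agrees with the solution. *)

From mathcomp Require Import all_boot.
Require Import Defs.

Set Implicit Arguments.
Unset Strict Implicit.
Unset Printing Implicit Defensive.

(** * Propositional and modal reasoning in GL *)

Ltac bool_cases :=
  rewrite /=; repeat match goal with
  | |- context [peval ?v ?A] => case: (peval v A) => //=
  | |- context [?v (Box ?A)] => case: (v (Box A)) => //=
  | |- context [?v (Var ?n)] => case: (v (Var n)) => //=
  end.

Ltac gl_taut := apply: GL_taut; move=> ?; bool_cases.

Lemma GL_cons1 A B : (forall v, peval v A ==> peval v B) -> GL A -> GL B.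
Proof. by move=> AB; apply: GL_mp; apply: GL_taut. Qed.

Lemma GL_cons2 A B C :
  (forall v, peval v A ==> peval v B ==> peval v C) -> GL A -> GL B -> GL C.
Proof. by move=> ABC gA; apply: GL_mp; apply: GL_mp gA; apply: GL_taut. Qed.

Lemma GL_cons3 A B C D :
  (forall v, peval v A ==> peval v B ==> peval v C ==> peval v D) ->
  GL A -> GL B -> GL C -> GL D.
Proof.
by move=> ABCD gA gB; apply: GL_mp; apply: GL_mp gB; apply: GL_mp gA; apply: GL_taut.
Qed.

Ltac gl H := apply: (GL_cons1 _ H); move=> ?; bool_cases.
Ltac gl2 H1 H2 := apply: (GL_cons2 _ H1 H2); move=> ?; bool_cases.
Ltac gl3 H1 H2 H3 := apply: (GL_cons3 _ H1 H2 H3); move=> ?; bool_cases.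

Lemma GL_trans A B C : GL (Imp A B) -> GL (Imp B C) -> GL (Imp A C).
Proof. by move=> AB BC; gl2 AB BC. Qed.

Lemma GL_iff_refl A : GL (Iff A A).
Proof. gl_taut. Qed.

Lemma GL_iff_sym A B : GL (Iff A B) -> GL (Iff B A).
Proof. by move=> AB; gl AB. Qed.

Lemma GL_iff_trans A B C : GL (Iff A B) -> GL (Iff B C) -> GL (Iff A C).
Proof. by move=> AB BC; gl2 AB BC. Qed.

Lemma GL_box_mono A B : GL (Imp A B) -> GL (Imp (Box A) (Box B)).
Proof. by move=> AB; apply: GL_mp (GL_K A B) (GL_nec AB). Qed.

Lemma GL_box_mono2 A B C :
  GL (Imp A (Imp B C)) -> GL (Imp (Box A) (Imp (Box B) (Box C))).
Proof. by move=> ABC; apply: GL_trans (GL_box_mono ABC) (GL_K B C). Qed.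

Lemma GL_box_iff K A B :
  GL (Imp K (Iff A B)) -> GL (Imp (Box K) (Iff (Box A) (Box B))).
Proof.
move=> KAB.
have AB : GL (Imp K (Imp A B)) by gl KAB.
have BA : GL (Imp K (Imp B A)) by gl KAB.
gl2 (GL_box_mono2 AB) (GL_box_mono2 BA).
Qed.

(* Löb's axiom for [A /\ Box A]. *)
Lemma GL_4 A : GL (Imp (Box A) (Box (Box A))).
Proof.
set B := And A (Box A).
have BA : GL (Imp (Box B) (Box A)) by apply: GL_box_mono; gl_taut.
have BbA : GL (Imp (Box B) (Box (Box A))) by apply: GL_box_mono; gl_taut.
have AB : GL (Imp A (Imp (Box B) B)) by gl BA.
exact: GL_trans (GL_trans (GL_box_mono AB) (GL_Lob B)) BbA.
Qed.

Lemma GL_lob_rule A : GL (Imp (Box A) A) -> GL A.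
Proof. by move=> bAA; apply: (GL_mp bAA); apply: GL_mp (GL_Lob A) (GL_nec bAA). Qed.

Definition dotbox (H : form) : form := And H (Box H).

Lemma GL_dotbox_box H : GL (Imp (Box H) (Box (dotbox H))).
Proof.
have HH : GL (Imp H (Imp (Box H) (dotbox H))) by gl_taut.
gl2 (GL_box_mono2 HH) (GL_4 H).
Qed.

(** [dotbox H] implies its own box, so Löb's rule for the implication from [dotbox H] to [A] needs
    only the stated premise. *)
Lemma GL_lob_rule_rel H A :
  GL (Imp (dotbox H) (Imp (Box A) A)) -> GL (Imp (dotbox H) A).
Proof.
move=> HA; apply: GL_lob_rule.
have bK := GL_K (dotbox H) A.
by gl3 HA bK (GL_dotbox_box H).
Qed.

(* With [F] for [Box C] and [Y] for [Box D]: from [Y], both [Box Y] and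
   [Box (C <-> D)] follow; the converse needs Löb's rule for [F -> Y]. *)
Lemma GL_box_pin F Y C D :
  GL (Iff F (Box C)) -> GL (Iff Y (Box D)) ->
  GL (Imp (dotbox Y) (Iff C D)) -> GL (Iff F Y).
Proof.
move=> FC YD YCD.
have bYCD : GL (Imp (Box Y) (Iff (Box C) (Box D))).
  exact: GL_trans (GL_dotbox_box Y) (GL_box_iff YCD).
(* Axiom 4 passes to any formula equivalent to a boxed one. *)
have trans4 X E : GL (Iff X (Box E)) -> GL (Imp X (Box X)).
  move=> XE.
  have EX : GL (Imp (Box E) X) by gl XE.
  by gl3 XE (GL_4 E) (GL_box_mono EX).
have FY : GL (Imp F Y).
  apply: GL_lob_rule.
  have step : GL (Imp (Box Y) (Imp F Y)) by gl3 bYCD FC YD.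
  by gl3 (GL_K F Y) (trans4 _ _ FC) step.
have YF : GL (Imp (Box Y) (Imp Y F)) by gl3 bYCD FC YD.
by gl3 FY YF (trans4 _ _ YD).
Qed.

(** * Congruence of the connectives and finite conjunctions *)

Lemma app_box l : l = LBox ->
  exists i : 'I_(arity l), forall t : (arity l).-tuple form, app t = Box (tnth t i).
Proof. by move=> ->; exists ord0. Qed.

(** Boxes are excluded: an equivalence under [K] passes through a box only under [Box K]. *)
Lemma app_congr_rel l K (s t : (arity l).-tuple form) : l != LBox ->
  (forall i, GL (Imp K (Iff (tnth s i) (tnth t i)))) ->
  GL (Imp K (Iff (app s) (app t))).
Proof.
case: l s t => [||n|||||] s t //= lB st; try by gl_taut.
- by gl (st ord0).
- by rewrite eqxx in lB.
- by gl2 (st ord0) (st ord_max).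
- by gl2 (st ord0) (st ord_max).
- by gl2 (st ord0) (st ord_max).
Qed.

Lemma app_congr l (s t : (arity l).-tuple form) :
  (forall i, GL (Iff (tnth s i) (tnth t i))) -> GL (Iff (app s) (app t)).
Proof.
move=> st.
have st' i : GL (Imp Top (Iff (tnth s i) (tnth t i))) by gl (st i).
have [/app_box[i E]|lB] := eqVneq l LBox; last by gl (app_congr_rel lB st').
have gT : GL (Box Top) by apply: GL_nec; gl_taut.
by rewrite !E; gl2 (GL_box_iff (st' i)) gT.
Qed.

Definition conj_all (T : Type) (s : seq T) (A : T -> form) : form :=
  foldr (fun v B => And (A v) B) Top s.

Lemma GL_conj_all_elim (T : eqType) (s : seq T) A v : v \in s -> GL (Imp (conj_all s A) (A v)).
Proof.
elim: s => //= w s IH; rewrite inE => /orP[/eqP->|/IH vs]; first by gl_taut.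
by gl vs.
Qed.

Lemma GL_conj_all_intro (T : Type) (s : seq T) A K :
  (forall v, GL (Imp K (A v))) -> GL (Imp K (conj_all s A)).
Proof. by move=> KA; elim: s => [|v s IH] /=; [gl_taut | gl2 (KA v) IH]. Qed.

(** * Systems of modal equations: uniqueness *)

Definition unboxed_step (g : pregraph) : rel g := fun a b => (lab a != LBox) && edge a b.
Arguments unboxed_step {g} a b.

Definition depth (g : pregraph) (a : g) : nat := #|connect unboxed_step a|.

(* Otherwise the edge would close a cycle without box. *)
Lemma depth_succ (g : pregraph) (a b : g) :
  guarded g -> lab a != LBox -> edge a b -> depth b < depth a.
Proof.
move=> gg la ab; have sab : unboxed_step a b by rewrite /unboxed_step la.
apply: proper_card; apply/properP; split.
  by apply/subsetP => x; apply: connect_trans (connect1 sab).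
exists a; first exact: connect0.
apply/negP => /connectP[q0 pq0 aE].
case/shortenP: pq0 aE => q pq Uq _ aE.
have cq : cycle unboxed_step (b :: q) by rewrite /= rcons_path pq -aE.
have cC : is_cycle [set x in b :: q].
  apply/is_cycleP; exists (b :: q); split=> // [|x]; last by rewrite inE.
  by apply: sub_cycle cq => x y /andP[].
have [x xC lx] := gg _ cC.
have xq : x \in b :: q by rewrite inE in xC.
by have := next_cycle cq xq; rewrite /= /unboxed_step lx eqxx.
Qed.

Definition solves (g : pregraph) (x : g -> form) (a : g) : Prop :=
  GL (Iff (x a) (app (map_tuple x (succ a)))).

(** The hypothesis [H] covers vertices where an equation may fail. Given [Box A], equivalence is
    immediate at box vertices and climbs to the others by induction on depth; relative Löb then
    discharges [Box A]. *)
Lemma solution_unique (g : pregraph) (x y : g -> form) H : guarded g ->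
  (forall a, (solves x a /\ solves y a) \/ GL (Imp H (Iff (x a) (y a)))) ->
  forall a, GL (Imp (dotbox H) (Iff (x a) (y a))).
Proof.
move=> gg xy; set E := fun a => Iff (x a) (y a); set A := conj_all (enum g) E.
suff EA a : GL (Imp (And (dotbox H) (Box A)) (E a)).
  have HA : GL (Imp (dotbox H) A).
    by apply: GL_lob_rule_rel; gl (GL_conj_all_intro (enum g) EA).
  by move=> a; apply: GL_trans HA (GL_conj_all_elim _ _); rewrite mem_enum.
have [n] := ubnP (depth a); elim: n a => // n IH a an.
case: (xy a) => [[xa ya]|Ha]; last by rewrite /E; gl Ha.
have [lB|lB] := eqVneq (lab a) LBox.
  have [i Ei] := app_box lB; rewrite /solves !Ei !tnth_map in xa ya.
  have AE : GL (Imp A (E (tnth (succ a) i))) by apply: GL_conj_all_elim; rewrite mem_enum.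
  by rewrite /E; gl3 (GL_box_iff AE) xa ya.
have EE : GL (Imp (And (dotbox H) (Box A))
                  (Iff (app (map_tuple x (succ a))) (app (map_tuple y (succ a))))).
  apply: app_congr_rel => // i; rewrite !tnth_map; apply: IH.
  by apply: leq_trans (depth_succ gg lB (mem_tnth _ _)) _; rewrite -ltnS.
by rewrite /E; gl3 EE xa ya.
Qed.

(** * Systems of modal equations: existence *)

(* [P] prescribes the value at some vertices; those are exempt from the system. *)
Definition pin_solves (g : pregraph) (P : g -> option form) (x : g -> form) (a : g) : Prop :=
  if P a is Some A then GL (Iff (x a) A) else solves x a.

(** The default [Bot] is never reached once all box vertices are pinned and the fuel [n] is at least
    the depth. *)
Fixpoint unfolding (g : pregraph) (P : g -> option form) (n : nat) (a : g) : form :=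
  if P a is Some A then A
  else if n is m.+1 then app (map_tuple (unfolding P m) (succ a)) else Bot.

Lemma unfolding_stable (g : pregraph) (P : g -> option form) n m (a : g) :
  guarded g -> (forall b, lab b = LBox -> P b) ->
  depth a <= n -> depth a <= m -> unfolding P n a = unfolding P m a.
Proof.
move=> gg PB.
have d0 (b : g) : 0 < depth b by apply/card_gt0P; exists b; apply: connect0.
elim: n m a => [|n IH] [|m] a; try by rewrite leqNgt d0.
  by move=> _; rewrite leqNgt d0.
move=> an am /=; case Pa: (P a) => [A|] //; congr app; apply: eq_from_tnth => i.
have la : lab a != LBox by apply/eqP => /PB; rewrite Pa.
have da := depth_succ gg la (mem_tnth i (succ a)).
by rewrite !tnth_map; apply: IH; rewrite -ltnS (leq_trans da).
Qed.

(** Induction on the number of unpinned box vertices; with none left, the equations simply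
    unfold. *)
Lemma pin_solution (g : pregraph) (P : g -> option form) : guarded g ->
  exists x, forall a, pin_solves P x a.
Proof.
move=> gg; have [n] := ubnP #|[set a : g | (lab a == LBox) && ~~ P a]|.
elim: n P => // n IH P Pn.
case: (pickP [pred a : g | (lab a == LBox) && ~~ P a]) => [a /=/andP[/eqP la Pa]|PB].
  pose pin A b := if b == a then Some A else P b.
  have pin_lt A : #|[set b : g | (lab b == LBox) && ~~ pin A b]| < n.
    rewrite -ltnS; apply: leq_trans Pn; rewrite ltnS; apply: proper_card.
    apply/properP; split; last by exists a; rewrite !inE la /pin !eqxx /=.
    apply/subsetP => b; rewrite !inE /pin; case: (b =P a) => [_|//].
    by rewrite andbF.
  have [z zP] := IH _ (pin_lt Top).
  have [y yP] := IH _ (pin_lt (app (map_tuple z (succ a)))).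
  have [i Ei] := app_box la.
  have yF := yP a; rewrite /pin_solves /pin eqxx Ei tnth_map in yF.
  set F := Box _ in yF.
  (* At [a] the values are [F] and [Top] up to equivalence, so they agree under [F]. *)
  have FS : GL (Imp (dotbox F) (Iff (y (tnth (succ a) i)) (z (tnth (succ a) i)))).
    apply: (solution_unique gg) => b; have := zP b; have := yP b.
    rewrite /pin_solves /pin; case: eqP => [-> _ za|_]; first by right; gl2 za yF.
    case: (P b) => [A yb zb|yb zb]; [right | by left].
    by gl2 yb zb.
  exists y => b; have := yP b; rewrite /pin_solves /pin; case: eqP => [-> _|//].
  case: (P a) Pa => // _; rewrite /solves Ei tnth_map.
  by apply: GL_iff_trans yF (GL_iff_sym _); apply: GL_box_pin FS; apply: GL_iff_refl.
have PB' b : lab b = LBox -> P b by move=> lb; have := PB b; rewrite /= lb eqxx; case: (P b).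
exists (unfolding P #|g|) => a; rewrite /pin_solves.
case Pa: (P a) => [A|]; first by case: #|g| => [|k] /=; rewrite Pa; apply: GL_iff_refl.
(* [#|g|] bounds every depth; one extra unit of fuel exposes the equation at [a]. *)
rewrite /solves (@unfolding_stable g P #|g| #|g|.+1) ?max_card ?leqW ?max_card //=.
by rewrite Pa; apply: GL_iff_refl.
Qed.

Lemma solution_exists (g : pregraph) : guarded g -> exists x : g -> form, forall a, solves x a.
Proof. exact: (pin_solution (fun=> None)). Qed.

(** * Agreement of [js] with the solution *)

Lemma root_on_cycle_loop_topE (psi : formula) : on_cycle (root psi) ->
  exists acc grd, loop_subst psi top_formula =
    @Formula (subst_graph (cut_graph psi (fresh psi)) (fresh psi) top_graph) acc grd.
Proof.
move=> cr; set p := fresh psi.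
have [acc [grd cutE]] : exists acc grd, cut psi p = @Formula (cut_graph psi p) acc grd.
  rewrite /cut; case: {-}_ / boolP => [h|]; last by rewrite cr.
  by do 2!eexists.
rewrite /loop_subst cutE /subst; case: {-}_ / boolP => [h|]; first by do 2!eexists.
by case/existsP; exists None; rewrite /= eqxx.
Qed.

(** Edges into the root are redirected to the fresh vertex, which becomes the vertex labelled
    [LTop]; hence references to the root read as [Top], while [z] at the root keeps its own
    value. *)
Lemma loop_top_solution (psi : formula) : on_cycle (root psi) ->
  (forall b : loop_subst psi top_formula, solves (@js _) b) ->
  exists2 z : psi -> form, z (root psi) = js (root (loop_subst psi top_formula)) &
    forall b, GL (Iff (z b)
      (app (map_tuple (fun c => if c == root psi then Top else z c) (succ b)))).
Proof.
move=> /root_on_cycle_loop_topE[acc [grd ->]]; set L := Formula acc grd => jsL.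
pose inj (c : option psi) : L := @subst_inj (cut_graph psi (fresh psi)) (fresh psi) top_graph c.
exists (fun b => js (inj (Some b))) => // b.
have injE := @subst_injP (cut_graph psi (fresh psi)) (fresh psi) top_graph.
rewrite {1}/inj; case: (injE (Some b)) => [[[c cp] /= cE ->]|[/= lb _]]; last first.
  by exfalso; have /existsPn/(_ b) := fresh_occurs psi; rewrite lb eqxx.
subst c; apply: GL_iff_trans (jsL _) _ => /=; apply: app_congr => i.
rewrite !tnth_map /redirect; case: eqP => _; last exact: GL_iff_refl.
case: (injE None) => [[[c' cp'] /= cE' _]|[_ ->]]; last exact: jsL (inr tt).
by exfalso; move: cp'; rewrite cE' /= eqxx.
Qed.

Lemma js_solution (phi : formula) (y : phi -> form) : (forall a, solves y a) ->
  forall a, GL (Iff (js a) (y a)).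
Proof.
have [n] := ubnP (ncycles phi); elim: n phi y => // n IHn phi y phin ySol a.
have [m] := ubnP (rank (mknode a)); elim: m a => // m IHm a am.
rewrite js_eq; case: ifPn => [sa|na]; last first.
  apply: GL_iff_trans (GL_iff_sym (ySol a)).
  apply: app_congr => i; rewrite !tnth_map; apply: IHm.
  have [|[_ lt]] := node_lt_succ i na; first by rewrite ltnn.
  by apply: leq_trans lt _; rewrite -ltnS.
case/andP: (sa) => /eqP la ca; set psi := gen a.
(* The looped formula has fewer cycles, so there [js] agrees with some solution and is itself
   one. *)
have jsSol (b : loop_subst psi top_formula) : solves (@js _) b.
  have [x xSol] := solution_exists (@formula_guarded (loop_subst psi top_formula)).
  have jsx := IHn _ x (leq_trans (loop_top_ncycles ca) phin) xSol.
  apply: GL_iff_trans (jsx b) (GL_iff_trans (xSol b) _).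
  by apply: app_congr => i; rewrite !tnth_map; apply: GL_iff_sym.
have [z <- zSol] := @loop_top_solution psi (gen_on_cycle ca) jsSol.
pose z' c := if c == root psi then Top else z c.
pose y' (c : psi) := y (val c).
have y'Sol c : solves y' c.
  apply: GL_iff_trans (ySol (val c)) _; apply: app_congr => i.
  by rewrite !tnth_map tnth_ord_tuple; apply: GL_iff_refl.
have lr : lab (root psi) = LBox by [].
have [i Ei] := app_box lr.
have zr := zSol (root psi); have yr := y'Sol (root psi).
rewrite /solves !Ei !tnth_map in zr yr.
apply: GL_box_pin zr yr _.
(* Here [H] is the value of [y'] at the root, the only vertex where [z'] need not solve the
   system. *)
apply: (solution_unique (x := z') (formula_guarded (f := psi))) => c.
rewrite {2}/z'; have [->|nc] := eqVneq c (root psi); [right; gl_taut | left].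
by split=> //; rewrite /solves {1}/z' (negPf nc); apply: zSol.
Qed.

Theorem theorem4p11 (phi : formula) (a : phi) :
  GL (Iff (js a) (app (map_tuple (@js phi) (succ a)))).
Proof.
have [y ySol] := solution_exists (@formula_guarded phi).
have jsy := js_solution ySol.
apply: GL_iff_trans (jsy a) (GL_iff_trans (ySol a) _).
by apply: app_congr => i; rewrite !tnth_map; apply: GL_iff_sym.
Qed.
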